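(* Let $w_x\in\mathscr X$ be fixed, and let $\mathcal A,\mathcal B$ be the block operators described in the context, with $\bar{\mathcal D}=\mathrm{dom}(\mathcal A)\cap\mathrm{dom}(\mathcal B)$. (I) Let $\mathcal K_x:\mathrm{dom}(\mathcal K_x)\subseteq\mathscr U\to\mathscr X$ be an upper block-triangular operator matrix such that $\mathrm{ran}(\mathcal A)\subseteq\bar{\mathcal D}$, $\mathrm{ran}(\mathcal B)\subseteq\mathrm{dom}(\mathcal K_x)$ and $\mathrm{ran}(\mathcal K_x)\subseteq\bar{\mathcal D}$. Then any trajectory $(x,u)\in\mathscr X\times\mathscr U$ satisfying the closed-loop dynamics $$\langle x,f\rangle_{\mathscr X}=\langle x,\mathcal A f\rangle_{\mathscr X}+\langle u,\mathcal B f\rangle_{\mathscr U}+\langle w_x,f\rangle_{\mathscr X}\quad\forall f\in\bar{\mathcal D},\qquad (\mathrm{Dyn})$$ $$\langle u,h\rangle_{\mathscr U}=\langle x,\mathcal K_x h\rangle_{\mathscr X}\quad\forall h\in\mathrm{dom}(\mathcal K_x),\qquad (\mathrm{Ctrl})$$ also satisfies $$\langle x,f\rangle_{\mathscr X}=\langle w_x,\theta_x f\rangle_{\mathscr X}\ \ \forall f\in\mathrm{dom}(\theta_x),\qquad \langle u,h\rangle_{\mathscr U}=\langle w_x,\theta_u h\rangle_{\mathscr X}\ \ \forall h\in\mathrm{dom}(\theta_u),\qquad (\mathrm{CLM})$$ for some causal (i.e. upper block-triangular) closed-loop maps $\theta_x:\mathrm{dom}(\theta_x)\subseteq\mathscr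 X\to\mathscr X$ and $\theta_u:\mathrm{dom}(\theta_u)\subseteq\mathscr U\to\mathscr X$ satisfying $\mathrm{ran}(\mathcal A)\subseteq\mathrm{dom}(\theta_x)$, $\mathrm{ran}(\mathcal B)\subseteq\mathrm{dom}(\theta_u)$ and $$\langle f,\theta_x\hat f\rangle_{\mathscr X}=\langle f,\theta_x\mathcal A\hat f\rangle_{\mathscr X}+\langle f,\theta_u\mathcal B\hat f\rangle_{\mathscr X}+\langle f,\hat f\rangle_{\mathscr X}\qquad\forall f\in\mathscr X,\ \forall\hat f\in\bar{\mathcal D}.\qquad (\mathrm{SLP})$$ (II) Let $\theta_x:\mathrm{dom}(\theta_x)\subseteq\mathscr X\to\mathscr X$ and $\theta_u:\mathrm{dom}(\theta_u)\subseteq\mathscr U\to\mathscr X$ be arbitrary closed-loop maps satisfying (SLP) such that $\theta_x,\theta_u$ are upper block-triangular (implying that $\theta_x$ is invertible), $\mathrm{ran}(\mathcal A)\subseteq\mathrm{dom}(\theta_x)$, $\mathrm{ran}(\mathcal B)\subseteq\mathrm{dom}(\theta_u)$ and $\mathrm{ran}(\theta_u)\subseteq\mathrm{dom}(\theta_x^{-1})$. Then the corresponding trajectory $(x,u)\in\mathscr X\times\mathscr U$ computed with (CLM) (i.e. satisfying (CLM)) also satisfies (Dyn), and satisfies (Ctrl) with the controller $\mathcal K_x:=\theta_x^{-1}\theta_u$, $\mathrm{dom}(\mathcal K_x):=\mathrm{dom}(\theta_u)$.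
   Context: $\mathcal X$ (state space) and $\mathcal U$ (input space) are real Hilbert spaces, finite- or infinite-dimensional. $T\in\mathbb N$ is a fixed time horizon. $\mathscr X:=\mathcal X^{T+1}$ is the Hilbert space of vectors $x=(x^0,\dots,x^T)$, $x^t\in\mathcal X$, with inner product $\langle x,\bar x\rangle_{\mathscr X}=\sum_{t=0}^T\langle x^t,\bar x^t\rangle_{\mathcal X}$; $\mathscr U:=\mathcal U^{T+1}$ is defined likewise. All operators are linear; the domain $\mathrm{dom}(\cdot)$ is part of the data of an operator, and $\mathrm{ran}(\cdot)$ denotes its range. Operators $A:\mathrm{dom}(A)\subseteq\mathcal X\to\mathcal X$ and $B:\mathrm{dom}(B)\subseteq\mathcal X\to\mathcal U$ are given (they are the adjoints of the operators $A^*,B^*$ in the discrete-time system $x^{t+1}=A^*x^t+B^*u^t+w_x^t$, which is understood weakly by testing against $f\in\mathrm{dom}(A)\cap\mathrm{dom}(B)$). The vector $w_x=(x^0,w^0,\dots,w^{T-1})\in\mathscr X$ collects the initial condition and the disturbances. The block operator $\mathcal A:\mathrm{dom}(\mathcal A)\subseteq\mathscr X\to\mathscr X$ is the $(T+1)\times(T+1)$ operator matrix with $A$ on the first block superdiagonal and zeros elsewhere: $(\mathcal A f)^t=A f^{t+1}$ for $0\le t\le T-1$ and $(\mathcal A f)^T=0$, with $\mathrm{dom}(\mathcal A)=\mathcal X\times\mathrm{dom}(A)^T$. The block operator $\mathcal B:\mathrm{dom}(\mathcal B)\subseteq\mathscr X\to\mathscr U$ is defined in the same way with $B$ in place of $A$.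 Set $\bar{\mathcal D}:=\mathrm{dom}(\mathcal A)\cap\mathrm{dom}(\mathcal B)=\mathcal X\times(\mathrm{dom}(A)\cap\mathrm{dom}(B))^T\subseteq\mathscr X$. An upper block-triangular (causal) operator matrix $M$ is a $(T+1)\times(T+1)$ matrix of linear operators whose blocks strictly below the diagonal vanish; the block in row $i$ and column $j\ge i$ ($0\le i\le j\le T$) is denoted $M^{j,j-i}$. For $\mathcal K_x$ and $\theta_u$ the blocks are operators $\mathrm{dom}(\cdot)\subseteq\mathcal U\to\mathcal X$; for $\theta_x$ they are operators $\mathrm{dom}(\cdot)\subseteq\mathcal X\to\mathcal X$. (The physical controller and closed-loop maps are the adjoints of these, which are lower block-triangular.) Identities such as (SLP) are understood to include that all expressions in them are defined for the indicated test elements.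
   Formalization: The remark that the hypotheses of (II) imply θ_x is invertible fails when dom(θ_x) is larger than D̄; only injectivity of θ_x on D̄ is proved. If θ_x is not injective, θ_x^{-1} denotes a choice of preimage; (Dyn) and (Ctrl) are still proved. *)

(* Defs.v *)
From HB Require Import structures.
From mathcomp Require Import all_boot all_order all_algebra sesquilinear.
From mathcomp Require Import all_classical all_reals all_analysis.
Set Implicit Arguments.
Unset Strict Implicit.
Unset Printing Implicit Defensive.
Import Order.TTheory GRing.Theory Num.Theory.
Import numFieldNormedType.Exports.
Local Open Scope classical_set_scope.
Local Open Scope ring_scope.

(* Real Hilbert space: complete for the norm induced by the inner product. *)
Record hilbert (R : realType) := Hilbert {
  hspace :> completeNormedModType R;
  ip : {dot hspace for (@idfun R)};
  ip_norm : forall x : hspace, ip x x = `|x| ^+ 2 }.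

Arguments ip {R} h.

(* vec H T is H^(T+1), with the sum of the componentwise inner products *)
Notation vec H T := {ffun 'I_T.+1 -> hspace H}.

Definition vip (R : realType) (H : hilbert R) (T : nat) (x y : vec H T) : R :=
  \sum_t ip H (x t) (y t).

(* Partially defined operator; only the values of [app] on [dom] matter. *)
Record op (V W : Type) := Op { dom : set V; app :> V -> W }.

Definition ran (V W : Type) (M : op V W) : set W := M @` dom M.

Section Operators.
Variable R : realType.
Implicit Types V W Z : lmodType R.

Definition linear_op V W (M : op V W) : Prop :=
  dom M 0 /\
  forall (a : R) (x y : V), dom M x -> dom M y ->
    dom M (a *: x + y) /\ M (a *: x + y) = a *: M x + M y.

Definition zero_op V W : op V W := Op setT (fun=> 0).

Definition injective_op V W (M : op V W) : Prop := set_inj (dom M) M.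

(* The domain of the inverse is [ran M]. If [M] is not injective on [dom M],
   the value at [w] is some preimage of [w] in [dom M]. *)
Definition inv_op V W (M : op V W) : op W V :=
  Op (ran M) (fun w => xget 0 [set v | dom M v /\ M v = w]).

Definition comp_op V W Z (N : op W Z) (M : op V W) : op V Z :=
  Op [set v | dom M v /\ dom N (M v)] (fun v => N (M v)).

Lemma inv_opP V W (M : op V W) (w : W) :
  ran M w -> dom M (inv_op M w) /\ M (inv_op M w) = w.
Proof.
case=> v Mv <- /=.
by case: xgetP => [x _ //|/(_ v)] []; split.
Qed.

Lemma inv_opK V W (M : op V W) (v : V) :
  injective_op M -> dom M v -> inv_op M (M v) = v.
Proof.
move=> Minj Mv.
have [] := @inv_opP _ _ M (M v); first by exists v.
by move=> Mv' eqM; apply: Minj; rewrite ?inE.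
Qed.

End Operators.

(* Operator matrix with (T+1) x (T+1) blocks; in the indexing by diagonals,
   M i j with i <= j is the block M^{j, j-i}. *)
Definition opmx (V W : Type) (T : nat) := 'I_T.+1 -> 'I_T.+1 -> op V W.

Section OperatorMatrices.
Variables (R : realType) (T : nat).
Implicit Types V W : lmodType R.

Definition mxop V W (M : opmx V W T) :
    op {ffun 'I_T.+1 -> V} {ffun 'I_T.+1 -> W} :=
  Op [set f : {ffun 'I_T.+1 -> V} | forall i j, dom (M i j) (f j)]
     (fun f => [ffun i => \sum_j M i j (f j)]).

Definition causal V W (M : opmx V W T) : Prop :=
  (forall i j, linear_op (M i j)) /\
  (forall i j : 'I_T.+1, (j < i)%N -> M i j = zero_op V W).

Definition superdiag V W (A : op V W) : opmx V W T :=
  fun i j => if j == i.+1 :> nat then A else zero_op V W.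

Lemma dom_superdiag V W (A : op V W) (f : {ffun 'I_T.+1 -> V}) :
  dom (mxop (superdiag A)) f <->
  (forall t : 'I_T.+1, (0 < t)%N -> dom A (f t)).
Proof.
split=> [fA t t0|fA i j]; last first.
  by rewrite /superdiag; case: eqP => //= ji; apply: fA; rewrite ji.
have lt : (t.-1 < T.+1)%N by apply: leq_ltn_trans (leq_pred t) (ltn_ord t).
by have := fA (Ordinal lt) t; rewrite /superdiag /= prednK // eqxx.
Qed.

Lemma superdiag_last V W (A : op V W) (f : {ffun 'I_T.+1 -> V}) :
  mxop (superdiag A) f ord_max = 0.
Proof.
rewrite ffunE big1 // => j _; rewrite /superdiag /=.
by case: eqP => // jT; have := ltn_ord j; rewrite jT ltnn.
Qed.

Lemma superdiag_lt V W (A : op V W) (f : {ffun 'I_T.+1 -> V})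
    (t s : 'I_T.+1) : s = t.+1 :> nat -> mxop (superdiag A) f t = A (f s).
Proof.
move=> st; rewrite ffunE (bigD1 s) //= {1}/superdiag st eqxx big1 ?addr0 //.
move=> j js; rewrite /superdiag; case: eqP => // jt.
by case/eqP: js; apply: val_inj; rewrite /= jt st.
Qed.

End OperatorMatrices.

Arguments superdiag {R} T {V W} A _ _.

Section ClosedLoop.
Variables (R : realType) (X U : hilbert R) (T : nat).
Variables (A : op X X) (B : op X U).

Definition calA : op (vec X T) (vec X T) := mxop (superdiag T A).
Definition calB : op (vec X T) (vec U T) := mxop (superdiag T B).
Definition Dbar : set (vec X T) := dom calA `&` dom calB.

Definition Dyn (w x : vec X T) (u : vec U T) : Prop :=
  forall f, Dbar f ->
    vip x f = vip x (calA f) + vip u (calB f) + vip w f.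

Definition Ctrl (K : op (vec U T) (vec X T)) (x : vec X T) (u : vec U T) :
    Prop :=
  forall h, dom K h -> vip u h = vip x (K h).

Definition CLM (thx : op (vec X T) (vec X T)) (thu : op (vec U T) (vec X T))
    (w x : vec X T) (u : vec U T) : Prop :=
  (forall f, dom thx f -> vip x f = vip w (thx f)) /\
  (forall h, dom thu h -> vip u h = vip w (thu h)).

(* The first conjunct says that every term of the identity is defined. *)
Definition SLP (thx : op (vec X T) (vec X T)) (thu : op (vec U T) (vec X T)) :
    Prop :=
  (forall g, Dbar g -> [/\ dom thx g, dom thx (calA g) & dom thu (calB g)]) /\
  (forall f g, Dbar g ->
    vip f (thx g) = vip f (thx (calA g)) + vip f (thu (calB g)) + vip f g).

End ClosedLoop.

Arguments calA {R X} T A.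
Arguments calB {R X U} T B.
Arguments Dbar {R X U} T A B _.

(* Main.v *)
Require Import Defs.
From HB Require Import structures.
From mathcomp Require Import all_boot all_order all_algebra sesquilinear.
From mathcomp Require Import all_classical all_reals all_analysis.
Import Order.TTheory GRing.Theory Num.Theory.
Import numFieldNormedType.Exports.
Local Open Scope classical_set_scope.
Local Open Scope ring_scope.


(** Part (I).  Substituting the controller into the dynamics turns them into
[<x, f> = <x, N f> + <w, f>] on [Dbar], where [N := calA + K calB].  The range
hypotheses on [calA], [calB] and [K] ensure that [N] is defined on [Dbar] and
maps it to itself, so that [N] can be iterated there.  Since [calA] and [calB] are strictly upper
triangular and [K] is upper triangular, [N] is nilpotent with [N^(T+1) = 0]
([loop_nilpotent]).  Unrolling the recursion therefore gives
[<x, f> = <w, thx f>] with the finite Neumann sum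
[thx := 1 + N + ... + N^T = (1 - N)^-1], and [<u, h> = <x, K h> = <w, thx K h>]
gives [thu := thx K].  The identity (SLP) is the fixed-point equation
[thx = thx N + 1] together with the additivity of [thx].

These maps are built as operators on whole vectors; [blocks] then recovers
causal operator matrices with the same domains and values.  This works because
the domains are products of one subspace per coordinate.

Part (II).  For [f] in [Dbar], (CLM) rewrites every term of (Dyn) as a pairing
with [w], and the result is (SLP) tested against [w].  For (Ctrl), if
[v := thx^-1 (thu h)] then [<x, v> = <w, thx v> = <w, thu h> = <u, h>].
Injectivity of [thx] on [Dbar] reads (SLP) as
[g = thx g - (thx calA g + thu calB g)]: when [thx g = 0], the right-hand side
depends at time [t] only on the entries of [g] after [t], so the entries of [g]
vanish one after the other, from the last to the first ([slp_ker]). *)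

Set Implicit Arguments.
Unset Strict Implicit.
Unset Printing Implicit Defensive.

(** * Partially defined linear operators *)

Section PartialLinearOperators.
Variable R : realType.
Implicit Types V W Z : lmodType R.

Lemma linear_op_lin V W (M : op V W) (a : R) (x y : V) : linear_op M ->
  dom M x -> dom M y -> dom M (a *: x + y) /\ M (a *: x + y) = a *: M x + M y.
Proof. by case=> _; apply. Qed.

Lemma linear_op_add V W (M : op V W) (x y : V) : linear_op M ->
  dom M x -> dom M y -> dom M (x + y) /\ M (x + y) = M x + M y.
Proof. by move=> lM Mx My; have := linear_op_lin 1 lM Mx My; rewrite !scale1r. Qed.

Lemma linear_op0 V W (M : op V W) : linear_op M -> dom M 0 /\ M 0 = 0.
Proof.
move=> lM; have M0 := lM.1; split=> //.
have [_ /eqP] := linear_op_add lM M0 M0.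
by rewrite addr0 -subr_eq subrr eq_sym => /eqP.
Qed.

Lemma linear_op_sum V W (M : op V W) (I : finType) (x : I -> V) :
  linear_op M -> (forall i, dom M (x i)) ->
  dom M (\sum_i x i) /\ M (\sum_i x i) = \sum_i M (x i).
Proof.
move=> lM Mx.
apply: (big_ind2 (fun u v => dom M u /\ M u = v)) => //.
  exact: linear_op0.
by move=> u _ v _ [Mu <-] [Mv <-]; apply: linear_op_add.
Qed.

Lemma linear_zero_op V W : linear_op (zero_op V W).
Proof. by split=> // a x y _ _; split=> //=; rewrite scaler0 addr0. Qed.

(** Without injectivity the preimages chosen by [inv_op] need not depend
linearly on the vector. *)
Lemma linear_op_comp_inv V W Z (N : op W V) (M : op Z V) : linear_op M ->
  linear_op N -> injective_op N -> ran M `<=` ran N ->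
  linear_op (comp_op (inv_op N) M).
Proof.
move=> lM lN injN MN.
have NM z : dom M z -> ran N (M z) by move=> Mz; apply: MN; exists z.
split=> [|a x y [Mx _] [My _]].
  by split; [exact: lM.1|apply: NM; exact: lM.1].
have [Mxy eMxy] := linear_op_lin a lM Mx My.
split; first by split=> //; exact: NM.
have [Nx eNx] := inv_opP (NM _ Mx); have [Ny eNy] := inv_opP (NM _ My).
have [Nxy eNxy] := linear_op_lin a lN Nx Ny.
by rewrite -[RHS](inv_opK injN Nxy) eNxy eNx eNy -eMxy.
Qed.

End PartialLinearOperators.

(** * Finite Neumann sums *)

Section NeumannSum.
Variables (R : realType) (V : lmodType R) (N : op V V).
Hypotheses (lN : linear_op N) (ranN : ran N `<=` dom N).

(** The partial sum [1 + N + ... + N^(n-1)] of the series of [(1 - N)^-1]. *)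
Definition neumann (n : nat) : op V V :=
  Op (dom N) (fun f => \sum_(k < n) iter k N f).

Lemma dom_iter k f : dom N f -> dom N (iter k N f).
Proof. by move=> Nf; elim: k => //= k IHk; apply: ranN; exists (iter k N f). Qed.

Lemma linear_neumann n : linear_op (neumann n).
Proof.
split=> [|a x y Nx Ny]; first exact: lN.1.
split; first by have [] := linear_op_lin a lN Nx Ny.
rewrite /= scaler_sumr -big_split; apply: eq_bigr => k _ /=.
elim: (val k) => //= m ->.
by have [] := linear_op_lin a lN (dom_iter m Nx) (dom_iter m Ny).
Qed.

Lemma neumannS n f : neumann n.+1 f = neumann n f + iter n N f.
Proof. exact: big_ord_recr. Qed.

(** Adding the vanishing term [N^n f] does not change the sum, and the longer
sum factors as [1 + (1 + ... + N^(n-1)) N]. *)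
Lemma neumann_fixpoint n f :
  iter n N f = 0 -> neumann n f = neumann n (N f) + f.
Proof.
move=> Nf0; have -> : neumann n f = neumann n.+1 f.
  by rewrite neumannS Nf0 addr0.
rewrite /neumann [LHS]/= big_ord_recl addrC; congr (_ + _); apply: eq_bigr => k _.
by rewrite /= -iterS iterSr.
Qed.

End NeumannSum.

(** * Block vectors and causal operator matrices *)

Section BlockVectors.
Variables (R : realType) (T : nat).
Implicit Types V W Z : lmodType R.

(** Causality is expressed through this filtration of the block vectors: upper
triangular matrices preserve it and strictly upper triangular ones shift it. *)
Definition vanishes_from V (m : nat) (f : {ffun 'I_T.+1 -> V}) : Prop :=
  forall t : 'I_T.+1, (m <= t)%N -> f t = 0.

Lemma vanishes_fromW V m n (f : {ffun 'I_T.+1 -> V}) :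
  (m <= n)%N -> vanishes_from m f -> vanishes_from n f.
Proof. by move=> mn f0 t nt; apply: f0; apply: leq_trans nt. Qed.

Lemma vanishes_from_end V (f : {ffun 'I_T.+1 -> V}) : vanishes_from T.+1 f.
Proof. by move=> t; rewrite leqNgt ltn_ord. Qed.

Lemma vanishes_from0 V (f : {ffun 'I_T.+1 -> V}) : vanishes_from 0 f -> f = 0.
Proof. by move=> f0; apply/ffunP => t; rewrite f0 // ffunE. Qed.

Lemma vanishes_fromD V m (f g : {ffun 'I_T.+1 -> V}) :
  vanishes_from m f -> vanishes_from m g -> vanishes_from m (f + g).
Proof. by move=> f0 g0 t mt; rewrite ffunE f0 // g0 // addr0. Qed.

Definition single V (j : 'I_T.+1) (v : V) : {ffun 'I_T.+1 -> V} :=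
  [ffun k => if k == j then v else 0].

Lemma sum_single V (f : {ffun 'I_T.+1 -> V}) : f = \sum_j single j (f j).
Proof.
apply/ffunP => k; rewrite sum_ffunE (bigD1 k) //= ffunE eqxx big1 ?addr0 //.
by move=> j jk; rewrite ffunE eq_sym (negPf jk).
Qed.

Lemma single0 V (j : 'I_T.+1) : single j (0 : V) = 0.
Proof. by apply/ffunP => k; rewrite !ffunE if_same. Qed.

Lemma single_lin V (j : 'I_T.+1) (a : R) (x y : V) :
  single j (a *: x + y) = a *: single j x + single j y.
Proof. by apply/ffunP => k; rewrite !ffunE; case: eqP; rewrite ?scaler0 ?addr0. Qed.

Lemma vanishes_from_single V (i j : 'I_T.+1) (v : V) :
  (j < i)%N -> vanishes_from i (single j v).
Proof.
move=> ji t it; rewrite ffunE; case: eqP => // tj.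
by have := leq_trans ji it; rewrite tj ltnn.
Qed.

Lemma linear_mxop V W (M : opmx V W T) :
  (forall i j, linear_op (M i j)) -> linear_op (mxop M).
Proof.
move=> lM; split=> [i j|a x y Mx My]; first by rewrite ffunE; exact: (lM i j).1.
have Mxy i j := linear_op_lin a (lM i j) (Mx i j) (My i j).
split=> [i j|]; first by rewrite !ffunE; exact: (Mxy i j).1.
apply/ffunP => i; rewrite !ffunE scaler_sumr -big_split; apply: eq_bigr => j _.
by rewrite !ffunE (Mxy i j).2.
Qed.

Lemma mxop_vanishes V W (M : opmx V W T) m f :
  causal M -> vanishes_from m f -> vanishes_from m (mxop M f).
Proof.
move=> [lM cM] f0 i mi; rewrite ffunE big1 // => j _.
have [ji|ij] := ltnP j i; first by rewrite cM.
by rewrite f0 ?(leq_trans mi) // (linear_op0 (lM i j)).2.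
Qed.

Lemma dom_mxop_single V W (M : opmx V W T) f j :
  (forall i k, linear_op (M i k)) ->
  dom (mxop M) f -> dom (mxop M) (single j (f j)).
Proof.
move=> lM Mf i k; rewrite ffunE; case: eqP => [->//|_]; exact: (lM i k).1.
Qed.

Lemma causal_superdiag V W (A : op V W) : linear_op A -> causal (superdiag T A).
Proof.
move=> lA; split=> i j; rewrite /superdiag; case: eqP => // ji.
- exact: linear_zero_op.
- by rewrite ji ltnNge leqnSn.
Qed.

Lemma superdiag_vanishes V W (A : op V W) m f : linear_op A ->
  vanishes_from m.+1 f -> vanishes_from m (mxop (superdiag T A) f).
Proof.
move=> lA f0 t mt; rewrite ffunE big1 // => j _; rewrite /superdiag.
by case: eqP => // jt; rewrite f0 ?jt // (linear_op0 lA).2.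
Qed.

(** The diagonal and upper blocks all carry the domain of their column, and a
lower block is the total zero operator, as [causal] prescribes. *)
Definition blocks V W (F : op {ffun 'I_T.+1 -> V} {ffun 'I_T.+1 -> W}) :
    opmx V W T :=
  fun i j => if (j < i)%N then zero_op V W
    else Op [set v | dom F (single j v)] (fun v => F (single j v) i).

Section Blocks.
Variables (V W : lmodType R) (F : op {ffun 'I_T.+1 -> V} {ffun 'I_T.+1 -> W}).
Hypothesis lF : linear_op F.
Hypothesis projF : forall f j, dom F f -> dom F (single j (f j)).
Hypothesis causalF :
  forall m f, dom F f -> vanishes_from m f -> vanishes_from m (F f).

Lemma causal_blocks : causal (blocks F).
Proof.
split=> i j; rewrite /blocks; last by move=> ->.
case: ifP => _; first exact: linear_zero_op.
split=> [|a x y Fx Fy] /=; first by rewrite single0; exact: lF.1.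
rewrite single_lin; have [Fxy ->] := linear_op_lin a lF Fx Fy.
by rewrite !ffunE.
Qed.

(** Column [j] constrains the [j]-th coordinate through its diagonal block, so
the matrix is defined on the product of the column domains; [projF] and
linearity make this product equal to [dom F]. *)
Lemma dom_blocks f : dom (mxop (blocks F)) f <-> dom F f.
Proof.
split=> [Ff|Ff i j]; last by rewrite /blocks; case: ifP => // _; exact: projF.
rewrite [f]sum_single; apply: (linear_op_sum lF _).1 => j.
by have := Ff j j; rewrite /blocks ltnn.
Qed.

(** The blocks below the diagonal, discarded in [blocks], contribute nothing
because [F] sends a vector supported at [j] to one that vanishes after [j]. *)
Lemma blocksE f : dom F f -> mxop (blocks F) f = F f.
Proof.
move=> Ff; have Ffj j := projF j Ff.
rewrite [in RHS](sum_single f) (linear_op_sum lF Ffj).2.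
apply/ffunP => i; rewrite ffunE sum_ffunE; apply: eq_bigr => j _.
rewrite /blocks; case: ifP => // ji /=.
by rewrite (causalF (Ffj j) (vanishes_from_single _ ji)).
Qed.

End Blocks.

End BlockVectors.

(** * The inner product of block vectors *)

Section InnerProduct.
Variables (R : realType) (H : hilbert R) (T : nat).
Implicit Types x y z : vec H T.

Lemma vipDr x y z : vip x (y + z) = vip x y + vip x z.
Proof.
by rewrite /vip -big_split; apply: eq_bigr => t _; rewrite ffunE linearDr.
Qed.

Lemma vip0r x : vip x 0 = 0.
Proof. by apply: (addrI (vip x 0)); rewrite -vipDr !addr0. Qed.

Lemma vipNr x y : vip x (- y) = - vip x y.
Proof. by apply/eqP; rewrite -addr_eq0 -vipDr addNr vip0r. Qed.

Lemma vip_definite x : vip x x = 0 -> x = 0.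
Proof.
rewrite /vip => /eqP; rewrite psumr_eq0; last first.
  by move=> t _; rewrite ip_norm exprn_ge0.
move=> /allP x0; apply/ffunP => t; rewrite ffunE.
have := x0 t (mem_index_enum t).
by rewrite /= ip_norm expf_eq0 /= normr_eq0 => /eqP.
Qed.

Lemma vip_ext x y : (forall f, vip f x = vip f y) -> x = y.
Proof.
move=> xy; apply/eqP; rewrite -subr_eq0; apply/eqP/vip_definite.
by rewrite vipDr vipNr xy subrr.
Qed.

End InnerProduct.

(** * Closed-loop maps and controllers *)

Section ClosedLoopMaps.
Variables (R : realType) (X U : hilbert R) (T : nat).
Variables (A : op X X) (B : op X U) (w : vec X T).
Hypotheses (lA : linear_op A) (lB : linear_op B).

Let linA : linear_op (calA T A).
Proof. exact: linear_mxop (causal_superdiag T lA).1. Qed.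

Let linB : linear_op (calB T B).
Proof. exact: linear_mxop (causal_superdiag T lB).1. Qed.

Let dom_single f j : Dbar T A B f -> Dbar T A B (single j (f j)).
Proof.
move=> [Af Bf]; split.
- exact: (dom_mxop_single _ (causal_superdiag T lA).1 Af).
- exact: (dom_mxop_single _ (causal_superdiag T lB).1 Bf).
Qed.

Section FromController.
Variable K : opmx U X T.
Hypothesis cK : causal K.
Hypothesis ranA : ran (calA T A) `<=` Dbar T A B.
Hypothesis ranB : ran (calB T B) `<=` dom (mxop K).
Hypothesis ranK : ran (mxop K) `<=` Dbar T A B.

Let linK : linear_op (mxop K).
Proof. exact: linear_mxop cK.1. Qed.

Definition loop_op : op (vec X T) (vec X T) :=
  Op (Dbar T A B) (fun f => calA T A f + mxop K (calB T B f)).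

Let loopE f : loop_op f = calA T A f + mxop K (calB T B f).
Proof. by []. Qed.

Let domBK f : Dbar T A B f -> dom (mxop K) (calB T B f).
Proof. by move=> [_ Bf]; apply: ranB; exists f. Qed.

Let domA f : Dbar T A B f -> Dbar T A B (calA T A f).
Proof. by move=> [Af _]; apply: ranA; exists f. Qed.

Let domK h : dom (mxop K) h -> Dbar T A B (mxop K h).
Proof. by move=> Kh; apply: ranK; exists h. Qed.

Lemma linear_loop : linear_op loop_op.
Proof.
split=> [|a x y Dx Dy]; first by split; [exact: linA.1|exact: linB.1].
have [Axy eA] := linear_op_lin a linA Dx.1 Dy.1.
have [Bxy eB] := linear_op_lin a linB Dx.2 Dy.2.
have [_ eK] := linear_op_lin a linK (domBK Dx) (domBK Dy).
by split=> //; rewrite !loopE eA eB eK scalerDr addrACA.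
Qed.

Lemma ran_loop : ran loop_op `<=` dom loop_op.
Proof.
move=> _ [f Df <-] /=; have [AAf BAf] := domA Df.
have [AKf BKf] := domK (domBK Df).
by split; [exact: (linear_op_add linA AAf AKf).1
          |exact: (linear_op_add linB BAf BKf).1].
Qed.

Lemma loop_vanishes m f : vanishes_from m.+1 f -> vanishes_from m (loop_op f).
Proof.
move=> f0; apply: vanishes_fromD; first exact: superdiag_vanishes.
by apply: mxop_vanishes => //; exact: superdiag_vanishes.
Qed.

(** Every application of [loop_op] clears one more entry at the end, and there
are [T + 1] entries. *)
Lemma loop_nilpotent f : iter T.+1 loop_op f = 0.
Proof.
have shift k : vanishes_from (T.+1 - k) (iter k loop_op f).
  elim: k => [|k IHk]; first exact: vanishes_from_end.
  rewrite iterS; apply: loop_vanishes; apply: vanishes_fromW IHk.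
  by rewrite subnS; exact: leqSpred.
by apply: vanishes_from0; rewrite -(subnn T.+1); exact: shift.
Qed.

Definition state_map : op (vec X T) (vec X T) := neumann loop_op T.+1.

Definition input_map : op (vec U T) (vec X T) :=
  Op (dom (mxop K)) (fun h => state_map (mxop K h)).

Lemma linear_state_map : linear_op state_map.
Proof. exact: linear_neumann linear_loop ran_loop _. Qed.

Lemma state_map_vanishes m f :
  vanishes_from m f -> vanishes_from m (state_map f).
Proof.
move=> f0 t mt; rewrite sum_ffunE big1 // => k _.
elim: (val k) t mt => [|n IHn] //=.
by apply: loop_vanishes; apply: vanishes_fromW IHn.
Qed.

Lemma linear_input_map : linear_op input_map.
Proof.
split=> [|a x y Kx Ky]; first exact: linK.1.
have [Kxy eK] := linear_op_lin a linK Kx Ky; split=> //.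
have [_] := linear_op_lin a linear_state_map (domK Kx) (domK Ky).
by rewrite -eK.
Qed.

(** This is [neumann_fixpoint], split along the two summands of
[loop_op g]. *)
Lemma state_map_slp g : Dbar T A B g ->
  state_map g = state_map (calA T A g) + input_map (calB T B g) + g.
Proof.
move=> Dg; rewrite {1}/state_map neumann_fixpoint ?loop_nilpotent //.
congr (_ + _).
exact: (linear_op_add linear_state_map (domA Dg) (domK (domBK Dg))).2.
Qed.

(** The closed loop reads [<x, f> = <x, N f> + <w, f>] with [N := loop_op].
Iterating it [n] times leaves the remainder [<x, N^n f>], which nilpotency
removes at [n = T + 1]. *)
Lemma state_map_clm x u f : Dyn A B w x u -> Ctrl (mxop K) x u ->
  Dbar T A B f -> vip x f = vip w (state_map f).
Proof.
move=> dyn ctrl Df.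
have step g : Dbar T A B g -> vip x g = vip x (loop_op g) + vip w g.
  by move=> Dg; rewrite (dyn g Dg) (ctrl _ (domBK Dg)) -vipDr.
have unroll n : vip x f = vip x (iter n loop_op f) + vip w (neumann loop_op n f).
  elim: n => [|n ->]; first by rewrite /= big_ord0 vip0r addr0.
  rewrite (step _ (dom_iter ran_loop n Df)) -addrA -vipDr.
  by rewrite neumannS (addrC (neumann _ _ _)).
by rewrite (unroll T.+1) loop_nilpotent vip0r add0r.
Qed.

Lemma causal_clm_exist : exists (thx : opmx X X T) (thu : opmx U X T),
  [/\ causal thx, causal thu,
      ran (calA T A) `<=` dom (mxop thx),
      ran (calB T B) `<=` dom (mxop thu) &
      SLP A B (mxop thx) (mxop thu)] /\
  forall (x : vec X T) (u : vec U T),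
    Dyn A B w x u -> Ctrl (mxop K) x u ->
    CLM (mxop thx) (mxop thu) w x u.
Proof.
have lx := linear_state_map; have lu := linear_input_map.
have px f j : dom state_map f -> dom state_map (single j (f j)).
  exact: dom_single.
have pu h j : dom input_map h -> dom input_map (single j (h j)).
  exact: dom_mxop_single cK.1.
have vx m f (_ : dom state_map f) := @state_map_vanishes m f.
have vu m h (_ : dom input_map h) (h0 : vanishes_from m h) :
    vanishes_from m (input_map h).
  exact: state_map_vanishes (mxop_vanishes cK h0).
have Ex := blocksE lx px vx; have Eu := blocksE lu pu vu.
have Dx f := dom_blocks lx px f; have Du h := dom_blocks lu pu h.
exists (blocks state_map), (blocks input_map); split.
- split; [exact: causal_blocks|exact: causal_blocks| | |].
  + by move=> f /ranA Df; apply/Dx.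
  + by move=> h /ranB Kh; apply/Du.
  + split=> [g Dg|f g Dg].
      split; [exact/Dx|exact/Dx/domA|exact/Du/domBK].
    rewrite (Ex _ Dg) (Ex _ (domA Dg)) (Eu _ (domBK Dg)) -!vipDr.
    by rewrite -state_map_slp.
- move=> x u dyn ctrl; split=> [f /Dx Df|h /Du Kh].
    by rewrite Ex // (state_map_clm dyn ctrl Df).
  by rewrite Eu // (ctrl _ Kh) (state_map_clm dyn ctrl (domK Kh)).
Qed.

End FromController.

Section ToController.
Variables (thx : opmx X X T) (thu : opmx U X T).
Hypotheses (cx : causal thx) (cu : causal thu).
Hypothesis slp : SLP A B (mxop thx) (mxop thu).

(** (SLP) makes the diagonal blocks of [thx] act as the identity on the entries
of [Dbar], so [thx] is unitriangular there: an equation [thx g = 0] is solved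
by back substitution from the last entry. *)
Lemma slp_ker g : Dbar T A B g -> mxop thx g = 0 -> g = 0.
Proof.
move=> Dg thg0.
have : mxop thx g = mxop thx (calA T A g) + mxop thu (calB T B g) + g.
  by apply: vip_ext => f; rewrite !vipDr; exact: slp.2.
rewrite thg0 => /esym/eqP; rewrite addrC addr_eq0 => /eqP gE.
(* [calA] and [calB] shift, so the right-hand side of [gE] vanishes one entry
   earlier than [g]. *)
have desc m : vanishes_from m.+1 g -> vanishes_from m g.
  move=> g0 t mt; rewrite gE ffunE.
  rewrite (vanishes_fromD (mxop_vanishes cx (superdiag_vanishes lA g0))
             (mxop_vanishes cu (superdiag_vanishes lB g0))) ?oppr0 //.
apply: vanishes_from0; move: (vanishes_from_end g).
by elim: (X in vanishes_from X g) => // m IHm /desc.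
Qed.

Lemma slp_inj : set_inj (Dbar T A B) (mxop thx).
Proof.
move=> g h /set_mem Dg /set_mem Dh egh; apply/eqP; rewrite -subr_eq0; apply/eqP.
have lin (V : lmodType R) (M : op (vec X T) V) := @linear_op_lin R _ _ M (-1) h g.
rewrite addrC -scaleN1r; apply: slp_ker.
  by split; [exact: (lin _ _ linA Dh.1 Dg.1).1|exact: (lin _ _ linB Dh.2 Dg.2).1].
have [thg _ _] := slp.1 g Dg; have [thh _ _] := slp.1 h Dh.
by rewrite (lin _ _ (linear_mxop cx.1) thh thg).2 egh scaleN1r addNr.
Qed.

Lemma clm_dyn x u : CLM (mxop thx) (mxop thu) w x u -> Dyn A B w x u.
Proof.
move=> [clmx clmu] f Df; have [xf xAf uBf] := slp.1 f Df.
by rewrite (clmx _ xf) (clmx _ xAf) (clmu _ uBf) slp.2.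
Qed.

End ToController.

Lemma clm_ctrl (thx : op (vec X T) (vec X T)) (thu : op (vec U T) (vec X T)) x u :
  CLM thx thu w x u -> Ctrl (comp_op (inv_op thx) thu) x u.
Proof.
move=> [clmx clmu] h [uh xuh]; have [xv ev] := inv_opP xuh.
by rewrite (clmu _ uh) [RHS](clmx _ xv) ev.
Qed.

End ClosedLoopMaps.

Theorem theorem1 (R : realType) (X U : hilbert R) (T : nat)
    (A : op X X) (B : op X U) (w : vec X T) :
  linear_op A -> linear_op B ->
  (* (I) *)
  (forall K : opmx U X T,
     causal K ->
     ran (calA T A) `<=` Dbar T A B ->
     ran (calB T B) `<=` dom (mxop K) ->
     ran (mxop K) `<=` Dbar T A B ->
     exists (thx : opmx X X T) (thu : opmx U X T),
       [/\ causal thx, causal thu,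
           ran (calA T A) `<=` dom (mxop thx),
           ran (calB T B) `<=` dom (mxop thu) &
           SLP A B (mxop thx) (mxop thu)] /\
       forall (x : vec X T) (u : vec U T),
         Dyn A B w x u -> Ctrl (mxop K) x u ->
         CLM (mxop thx) (mxop thu) w x u) /\
  (* (II) *)
  (forall (thx : opmx X X T) (thu : opmx U X T),
     causal thx -> causal thu ->
     SLP A B (mxop thx) (mxop thu) ->
     ran (calA T A) `<=` dom (mxop thx) ->
     ran (calB T B) `<=` dom (mxop thu) ->
     ran (mxop thu) `<=` dom (inv_op (mxop thx)) ->
     let K := comp_op (inv_op (mxop thx)) (mxop thu) in
     [/\ set_inj (Dbar T A B) (mxop thx),
         dom K = dom (mxop thu),
         injective_op (mxop thx) -> linear_op K &
         forall (x : vec X T) (u : vec U T),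
           CLM (mxop thx) (mxop thu) w x u ->
           Dyn A B w x u /\ Ctrl K x u]).
Proof.
move=> lA lB; split=> [K cK ranA ranB ranK|thx thu cx cu slp _ _ ranu].
  exact: causal_clm_exist.
move=> K; split.
- exact: slp_inj slp.
- apply/seteqP; split=> [h []//|h uh]; split=> //.
  by apply: ranu; exists h.
- move=> injx.
  exact: linear_op_comp_inv (linear_mxop cu.1) (linear_mxop cx.1) injx ranu.
- move=> x u clm; split; [exact: clm_dyn clm|exact: clm_ctrl clm].
Qed.
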